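(* Let $\mathcal{H}=\{rrr,bby,yyb\}$. Then $h_2(n,\mathcal{H})=\lceil n/2\rceil$.
   Context: Here $n$ denotes the number of vertices of the complete graph $K_n$. Edge-colorings of $K_n$ use colors from $\{r,b,y\}$ (red, blue, yellow); they need not be proper, and not all colors need be used. A pattern is an edge-colored triangle, denoted by the multiset of the colors of its three edges; e.g. $rrr$ is the all-red triangle, $bby$ is the triangle with two blue edges and one yellow edge, and $yyb$ has two yellow edges and one blue edge. For a family $\mathcal{H}$ of patterns, $\operatorname{Forb}(n,\mathcal{H})$ is the set of all edge-colorings of $K_n$ with colors from $\{r,b,y\}$ in which no triangle has a coloring belonging to $\mathcal{H}$. For an edge-coloring $c$ of $K_n$, $h_2(c)$ is the maximum $k$ such that there is a set of $k$ vertices whose induced edges use at most two of the three colors. Finally, $h_2(n,\mathcal{H})=\min\{h_2(c): c\in\operatorname{Forb}(n,\mathcal{H})\}$.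
   Formalization: The case n = 2 is excluded, because every coloring of K_2 has h_2(c) = 2 while ⌈2/2⌉ = 1, so the claimed equality fails there; all other n are covered. *)

(* Defs.v *)
From HB Require Import structures.
From mathcomp Require Import all_boot.

Set Implicit Arguments.
Unset Strict Implicit.
Unset Printing Implicit Defensive.

Inductive color := Red | Blue | Yellow.

Definition ord_of_color (a : color) : 'I_3 :=
  match a with
  | Red => @Ordinal 3 0 isT
  | Blue => @Ordinal 3 1 isT
  | Yellow => @Ordinal 3 2 isT
  end.

Definition color_of_ord (i : 'I_3) : color :=
  match val i with 0 => Red | 1 => Blue | _ => Yellow end.

Lemma ord_of_colorK : cancel ord_of_color color_of_ord.
Proof. by case. Qed.

HB.instance Definition _ := Equality.copy color (can_type ord_of_colorK).
HB.instance Definition _ := Choice.copy color (can_type ord_of_colorK).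
HB.instance Definition _ := Countable.copy color (can_type ord_of_colorK).
HB.instance Definition _ : isFinite color := CanIsFinite ord_of_colorK.

(* The edges of K_n: the 2-element subsets of the vertex set 'I_n. *)
Definition edge (n : nat) := {e : {set 'I_n} | #|e| == 2}.

Definition coloring (n : nat) := {ffun edge n -> color}.

Definition edges_in (n : nat) (S : {set 'I_n}) : {set edge n} :=
  [set e : edge n | val e \subset S].

(* A pattern is a multiset of three colors: the order in the tuple is
   irrelevant, as patterns are only ever compared up to perm_eq. *)
Definition pattern := 3.-tuple color.

Definition has_pattern (n : nat) (c : coloring n) (T : {set 'I_n})
    (p : pattern) : bool :=
  perm_eq [seq c e | e in edges_in T] p.

Definition Forb (n : nat) (H : seq pattern) : {set coloring n} :=
  [set c : coloring n | [forall T : {set 'I_n},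
     (#|T| == 3) ==> ~~ has (has_pattern c T) H]].

Definition h2 (n : nat) (c : coloring n) : nat :=
  \max_(S : {set 'I_n} | #|c @: edges_in S| <= 2) #|S|.

(* The minimum of h2 over Forb n H. Since h2 c <= n for every c, starting the
   iteration at n does not affect the minimum when Forb n H is nonempty; the
   value is n when Forb n H is empty. *)
Definition h2_min (n : nat) (H : seq pattern) : nat :=
  \big[minn/n]_(c in Forb n H) h2 c.

Definition rrr : pattern := [tuple Red; Red; Red].
Definition bby : pattern := [tuple Blue; Blue; Yellow].
Definition yyb : pattern := [tuple Yellow; Yellow; Blue].

(* Main.v *)
(** Lower bound.  In a coloring without [rrr], [bby], [yyb], a blue and a yellow
    edge sharing a vertex force the third edge of their triangle to be red.  If
    no vertex sees both blue and yellow, the vertices seeing no yellow and those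
    seeing no blue cover everything.  Otherwise let [v] see both, with
    neighbourhoods [B], [Y], [R].  Then [B] is a blue clique, [Y] a yellow clique,
    all edges between them are red, and [R] is monochromatic, say blue.  Each of
    [v |: B], [v |: Y], [v |: R] is 2-colored, so if one of [B], [Y], [R] has at
    most one element the other two give a large set; if all three have at least
    two elements, no edge between [B] and [R] is yellow, and [v |: (B :|: R)] and
    [v |: Y] cover everything.

    Upper bound.  Two blue cliques of sizes [uphalf n] and [n./2], joined by a
    yellow matching, all the other edges being red. *)
Require Import Defs.
From mathcomp Require Import all_boot.
From mathcomp Require Import zify.

Set Implicit Arguments.
Unset Strict Implicit.
Unset Printing Implicit Defensive.

(** * Lower bound for color functions on a finite vertex set *)

(** Since there are three colors, spanning at most two of them amounts to missing some [a]. The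
    condition [x != y] shuts out the conventional color of the diagonal. *)
Definition misses (T : finType) (k : T -> T -> color) (S : {set T}) (a : color) :=
  {in S &, forall x y, x != y -> k x y <> a}.

(* [p] and [q] are blue and yellow in either order, so that the two can be
   exchanged. *)
Record tame (T : finType) (k : T -> T -> color) (p q : color) : Prop := Tame {
  tame_pq : p <> q;
  tame_p : p <> Red;
  tame_q : q <> Red;
  tame_color : forall x y, [\/ k x y = p, k x y = q | k x y = Red];
  tame_sym : forall x y, k x y = k y x;
  tame_diag : forall x, k x x = Red;
  tame_rrr : forall x y z, x != y -> y != z -> x != z ->
    k x y = Red -> k y z = Red -> k x z <> Red;
  tame_red : forall x y z, k x y = p -> k x z = q -> k y z = Red
}.

Lemma tame_swap (T : finType) (k : T -> T -> color) (p q : color) :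
  tame k p q -> tame k q p.
Proof.
case=> pq pR qR kP kC kxx rrr red; split=> //.
- by move=> e; apply: pq.
- by move=> x y; case: (kP x y); [constructor 2 | constructor 1 | constructor 3].
- by move=> x y z xy xz; rewrite kC; apply: red xz xy.
Qed.

Definition nbhd (T : finType) (k : T -> T -> color) (v : T) (a : color) : {set T} :=
  [set u | (u != v) && (k v u == a)].

Lemma nbhdP (T : finType) (k : T -> T -> color) (v : T) (a : color) (u : T) :
  reflect (u != v /\ k v u = a) (u \in nbhd k v a).
Proof. by rewrite inE; apply: (iffP andP) => -[? /eqP]. Qed.

Lemma misses_nbhdU1 (T : finType) (k : T -> T -> color) (v : T) (A : {set T})
    (a : color) :
  (forall x y, k x y = k y x) -> {in A, forall x, k v x <> a} ->
  misses k A a -> misses k (v |: A) a.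
Proof.
move=> kC vA mA x y /setU1P[-> | xA] /setU1P[-> | yA] xy; last exact: mA.
- by rewrite eqxx in xy.
- exact: vA.
- by rewrite kC; apply: vA.
Qed.

Lemma other_elt (T : finType) (A : {set T}) (x : T) :
  1 < #|A| -> exists2 y, y \in A & y != x.
Proof.
case/card_gt1P=> y [z [yA zA yz]].
have [eyx | yx] := eqVneq y x; last by exists y.
by exists z; rewrite // -eyx eq_sym.
Qed.

Definition large_2colored (T : finType) (k : T -> T -> color) : Prop :=
  exists (S : {set T}) (a : color), misses k S a /\ #|T| <= #|S|.*2.

Lemma large_2colored_pair (T : finType) (k : T -> T -> color) (S1 S2 : {set T})
    (a1 a2 : color) :
  misses k S1 a1 -> misses k S2 a2 -> #|T| <= #|S1| + #|S2| ->
  large_2colored k.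
Proof.
move=> m1 m2 le; have [le12 | lt21] := leqP #|S1| #|S2|.
  by exists S2, a2; split=> //; lia.
by exists S1, a1; split=> //; lia.
Qed.

Section Tame.

Variables (T : finType) (k : T -> T -> color) (p q : color).
Hypothesis tk : tame k p q.

(** If [k x x'] were [q], then [p] on [x v] would make [v x'] red. If it were red, [x x' y] would be
    a red triangle, because [x y] and [x' y] are red by [tame_red] at [v]. *)
Lemma nbhd_clique (v x x' y : T) : k v x = p -> k v x' = p -> k v y = q ->
  x != x' -> k x x' = p.
Proof.
case: tk => pq pR _ kP kC _ rrr red vx vx' vy xx'; case: (kP x x') => // e.
  by have := red _ _ x' (etrans (kC x v) vx) e; rewrite vx' => /pR.
have xy := red _ _ _ vx vy; have x'y := red _ _ _ vx' vy.
have neq z : k v z = p -> z != y.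
  by move=> vz; apply/eqP => ezy; apply: pq; rewrite -vz ezy.
by case: (rrr _ _ _ xx' (neq _ vx') (neq _ vx)).
Qed.

Lemma nbhd_misses (v y : T) : k v y = q -> misses k (v |: nbhd k v p) q.
Proof.
move=> vy; apply: misses_nbhdU1 => [|x /nbhdP[_ ->]|]; first exact: tame_sym tk.
  exact: tame_pq tk.
move=> x x' /nbhdP[_ vx] /nbhdP[_ vx'] xx'.
by rewrite (nbhd_clique vx vx' vy xx'); apply: tame_pq tk.
Qed.

(** A red edge inside the red neighbourhood would close a red triangle with [v]. Edges [p] and [q]
    with a common end would force such a red edge. *)
Lemma nbhd_red_mono (v : T) :
  misses k (nbhd k v Red) q \/ misses k (nbhd k v Red) p.
Proof.
case: tk => pq pR qR kP kC kxx rrr red; set A := nbhd k v Red.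
have nonred : misses k A Red.
  move=> x y /nbhdP[xv vx] /nbhdP[yv vy] xy; apply: (rrr x v y) => //.
    by rewrite eq_sym.
  by rewrite kC.
have [/existsP[x /existsP[y /and4P[xA yA xy /eqP kxy]]] | nop] :=
  boolP [exists x, exists y, [&& x \in A, y \in A, x != y & k x y == p]].
(* The color [p] of [x y] spreads to all edges at [x], and from there to every other edge. *)
- have xP z : z \in A -> x != z -> k x z = p.
    move=> zA xz; case: (kP x z) => // e; last by case: (nonred x z).
    have yz : y != z by apply/eqP => eyz; apply: pq; rewrite -kxy eyz.
    by case: (nonred y z) => //; apply: red e.
  left=> z w zA wA zw kzw.
  have [exz | xz] := eqVneq x z; first by apply: pq; rewrite -kzw -exz xP // exz.
  have [exw | xw] := eqVneq x w.
    by apply: pq; rewrite -kzw -exw kC xP.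
  by case: (nonred x w) => //; apply: red kzw; rewrite kC xP.
- right=> x y xA yA xy kxy; case/negP: nop; apply/existsP; exists x.
  by apply/existsP; exists y; rewrite xA yA xy kxy eqxx.
Qed.

Lemma card_nbhds (v : T) :
  #|T| = (#|nbhd k v p| + #|nbhd k v q| + #|nbhd k v Red|).+1.
Proof.
case: tk => /eqP/negPf npq /eqP/negPf np /eqP/negPf nq kP _ _ _ _.
have sum u : (u \in [set~ v] : nat)
    = (u \in nbhd k v p) + (u \in nbhd k v q) + (u \in nbhd k v Red).
  rewrite !inE; case: (u != v) => //=.
  by case: (kP v u) => ->;
     rewrite ?eqxx ?np ?nq ?npq // ?[Red == _]eq_sym ?np ?nq // eq_sym npq.
have card_sum (A : {set T}) : #|A| = \sum_u (u \in A).
  by rewrite -sum1_card big_mkcond; apply: eq_bigr => u _; case: (u \in A).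
rewrite -cardsT (cardsD1 v) inE add1n setTD; congr _.+1.
by rewrite !card_sum -!big_split /=; apply: eq_bigr => u _; apply: sum.
Qed.

Lemma card_nbhdU1 (v : T) (a : color) : #|v |: nbhd k v a| = #|nbhd k v a|.+1.
Proof. by rewrite cardsU1 inE eqxx. Qed.

(** Suppose [k x r = q]. With a second vertex [x'] in the [p]-neighbourhood and a second vertex [r']
    in the red one, every edge from [r] to the [q]-neighbourhood of [v] becomes [p]. The vertices
    [y] and [y'] of that neighbourhood are then joined by [p] when seen from [r], but not when seen
    from [v]. *)
Lemma nbhd_pR_misses (v : T) : 1 < #|nbhd k v p| -> 1 < #|nbhd k v q| ->
  1 < #|nbhd k v Red| -> misses k (nbhd k v Red) q ->
  {in nbhd k v p & nbhd k v Red, forall x r, k x r <> q}.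
Proof.
move=> gB gY gR mR x r /nbhdP[xv vx] /[dup] rR /nbhdP[rv vr] xr.
case: tk => pq pR qR kP kC kxx rrr red.
have [y /nbhdP[yv vy] _] := other_elt v gY.
have [y' /nbhdP[y'v vy'] y'y] := other_elt y gY.
have [x' /nbhdP[x'v vx'] x'x] := other_elt x gB.
have [r' r'R r'r] := other_elt r gR.
have neq a b z w : a <> b -> k v z = a -> k v w = b -> z != w.
  by move=> ab vz vw; apply/eqP => ezw; apply: ab; rewrite -vz -vw ezw.
have /nbhdP[r'v vr'] := r'R.
have rr' : k r r' = p.
  case: (kP r r') => // e; first by case: (mR r r'); rewrite // eq_sym.
  by case: (rrr r r' v _ r'v rv); rewrite // 1?[r == _]eq_sym // kC.
have xx' : k x x' = p by apply: nbhd_clique vx vx' vy _; rewrite eq_sym.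
have rx : k r x = q by rewrite kC.
have x'r : k x' r = Red by apply: red xx' xr.
have r'x : k r' x = Red by apply: red rr' rx.
(* Color [q] on [r z] would give the red triangle [r' x z]; color red would give the red triangle
   [x' r z]. *)
have ry z : k v z = q -> k r z = p.
  move=> vz; case: (kP r z) => // e.
  - case: (rrr r' x z _ (neq _ _ _ _ pq vx vz) _ r'x (red _ _ _ vx vz)).
    + by rewrite eq_sym (neq _ _ _ _ pR vx vr').
    + by rewrite eq_sym (neq _ _ _ _ qR vz vr').
    + exact: red rr' e.
  - case: (rrr x' r z (neq _ _ _ _ pR vx' vr) _ (neq _ _ _ _ pq vx' vz) x'r e).
      by rewrite eq_sym (neq _ _ _ _ qR vz vr).
    exact: red vx' vz.
(* Here [nbhd_clique] is applied around [r], with [x] as the required [q]-neighbour. *)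
have y'y_p : k y' y = p by apply: nbhd_clique (ry _ vy') (ry _ vy) rx y'y.
by have := red _ _ v y'y_p (etrans (kC y' v) vy'); rewrite kC vy => /qR.
Qed.

Lemma nbhd_pR_large (v x0 y0 : T) : k v x0 = p -> k v y0 = q ->
  misses k (nbhd k v q) p -> misses k (nbhd k v Red) q -> large_2colored k.
Proof.
case: (tk) => pq pR qR _ kC _ _ _ vx vy mY' mR'.
have mB := nbhd_misses vy.
have mY : misses k (v |: nbhd k v q) p.
  by apply: misses_nbhdU1 => // z /nbhdP[_ ->] /esym.
have mR : misses k (v |: nbhd k v Red) q.
  by apply: misses_nbhdU1 => // z /nbhdP[_ ->] /esym.
have cT := card_nbhds v.
(* Two sets that share [v] count it twice, which pays for the at most one vertex of the
   neighbourhood left out. *)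
have [leB | gB] := leqP #|nbhd k v p| 1.
  by apply: (large_2colored_pair mY mR); rewrite !card_nbhdU1; lia.
have [leY | gY] := leqP #|nbhd k v q| 1.
  by apply: (large_2colored_pair mB mR); rewrite !card_nbhdU1; lia.
have [leR | gR] := leqP #|nbhd k v Red| 1.
  by apply: (large_2colored_pair mB mY); rewrite !card_nbhdU1; lia.
have mBR := nbhd_pR_misses gB gY gR mR'.
have mS : misses k (v |: (nbhd k v p :|: nbhd k v Red)) q.
  apply: misses_nbhdU1 => // [z /setUP[] /nbhdP[_ ->] // /esym //|].
  move=> z w /setUP[] zA /setUP[] wA zw.
  - by apply: mB; rewrite ?setU1r.
  - exact: mBR.
  - by rewrite kC; apply: mBR.
  - exact: mR'.
apply: (large_2colored_pair mS mY).
have disj : nbhd k v p :&: nbhd k v Red = set0.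
  apply: disjoint_setI0; rewrite disjoints_subset; apply/subsetP => z /nbhdP[_ vz].
  by rewrite !inE vz; apply/nandP; right; apply/eqP.
by rewrite card_nbhdU1 cardsU1 !inE eqxx cardsU disj cards0 cT; lia.
Qed.

End Tame.

Lemma tame_large (T : finType) (k : T -> T -> color) (p q : color) :
  tame k p q -> large_2colored k.
Proof.
move=> tk; have kC := tame_sym tk; have sk := tame_swap tk.
have [/existsP[v /andP[/existsP[x /eqP vx] /existsP[y /eqP vy]]] | nov] :=
  boolP [exists v, [exists x, k v x == p] && [exists y, k v y == q]].
  have mono a b z : tame k a b -> k v z = b -> misses k (nbhd k v a) b.
    move=> tab vz u w uA wA; apply: (nbhd_misses tab vz); exact: setU1r.
  (* If the red neighbourhood misses [p] instead of [q], the two colors are exchanged. *)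
  case: (nbhd_red_mono tk v) => mR.
    exact: (nbhd_pR_large tk vx vy (mono _ _ _ sk vx) mR).
  exact: (nbhd_pR_large sk vy vx (mono _ _ _ tk vy) mR).
set sees := fun a => [set v | [exists x, k v x == a]].
have mis a : misses k (~: sees a) a.
  by move=> u w; rewrite !inE => /existsPn/(_ w)/eqP.
apply: (large_2colored_pair (mis p) (mis q)).
rewrite -cardsUI -cardsT -[#|[set: T]|]addn0 leq_add // subset_leq_card //.
apply/subsetP => v _; move/existsPn/(_ v): nov.
by rewrite !inE negb_and.
Qed.

(** * From edge-colorings of the complete graph to color functions *)

(** The singleton [[set x; x]] is not an edge, so the diagonal gets the default [Red]. A blue or
    yellow value thus certifies that the two vertices differ. *)
Definition kcol (n : nat) (c : coloring n) (x y : 'I_n) : color :=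
  oapp c Red (insub [set x; y]).

Lemma kcol_edge (n : nat) (c : coloring n) (e : edge n) (x y : 'I_n) :
  val e = [set x; y] -> c e = kcol c x y.
Proof. by move=> exy; rewrite /kcol -exy valK. Qed.

Lemma kcolC (n : nat) (c : coloring n) (x y : 'I_n) : kcol c x y = kcol c y x.
Proof. by rewrite /kcol setUC. Qed.

Lemma kcol_diag (n : nat) (c : coloring n) (x : 'I_n) : kcol c x x = Red.
Proof. by rewrite /kcol insubN // setUid cards1. Qed.

Lemma edge_ex (n : nat) (x y : 'I_n) :
  x != y -> exists e : edge n, val e = [set x; y].
Proof.
move=> xy; have pe : #|[set x; y]| == 2 by rewrite cards2 xy.
by exists (Sub [set x; y] pe); rewrite SubK.
Qed.

(** The enumeration of [edges_in] has no prescribed order, hence [perm_eq], which is all that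
    patterns require. *)
Lemma triangle_colors (n : nat) (c : coloring n) (x y z : 'I_n) :
  x != y -> y != z -> x != z ->
  perm_eq [seq c e | e in edges_in [set x; y; z]]
          [:: kcol c x y; kcol c x z; kcol c y z].
Proof.
move=> xy yz xz.
have [exy vxy] := edge_ex xy; have [exz vxz] := edge_ex xz.
have [eyz vyz] := edge_ex yz.
rewrite -(kcol_edge c vxy) -(kcol_edge c vxz) -(kcol_edge c vyz).
have eqE_edge (e f : edge n) : (e == f) = (val e == val f) by [].
apply: (perm_map c (t := [:: exy; exz; eyz])); apply: uniq_perm.
- exact: enum_uniq.
- have zxy : z \notin [set x; y] by rewrite !inE negb_or eq_sym xz eq_sym yz.
  have yxz : y \notin [set x; z] by rewrite !inE negb_or eq_sym xy yz.
  rewrite /= !inE negb_or !andbT !eqE_edge vxy vxz vyz.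
  rewrite -andbA; apply/and3P; split; apply/eqP => e.
  + by rewrite e !inE eqxx orbT in zxy.
  + by rewrite e !inE eqxx orbT in zxy.
  + by rewrite e !inE eqxx in yxz.
- move=> e; rewrite mem_enum !inE !eqE_edge vxy vxz vyz; apply/idP/idP.
    have /cards2P[u [w [uw ->]]] := valP e; rewrite subUset !sub1set !inE.
    (* Nine choices of [(u, w)]: three have [u = w] and contradict [uw], the other six name the
       three edges in either order. *)
    move=> /andP[/orP[/orP[] | ] /eqP eu /orP[/orP[] | ] /eqP ew]; subst u w;
      first [by rewrite eqxx in uw | by rewrite eqxx ?orbT
            | by rewrite [_ :|: _]setUC eqxx ?orbT
            | by rewrite ![[set z; _]]setUC eqxx ?orbT].
  by case/or3P => /eqP ->; rewrite subUset !sub1set !inE !eqxx ?orbT.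
Qed.

Lemma ForbP (n : nat) (H : seq pattern) (c : coloring n) :
  reflect (forall x y z, x != y -> y != z -> x != z ->
      ~~ has (fun p : pattern =>
                perm_eq [:: kcol c x y; kcol c x z; kcol c y z] p) H)
    (c \in Forb n H).
Proof.
have eqh (x y z : 'I_n) : x != y -> y != z -> x != z ->
    has (has_pattern c [set x; y; z]) H
    = has (fun p : pattern =>
             perm_eq [:: kcol c x y; kcol c x z; kcol c y z] p) H.
  move=> xy yz xz; apply: eq_has => p; rewrite /has_pattern.
  by have /permPl -> := triangle_colors c xy yz xz.
rewrite inE; apply: (iffP forallP) => cF.
  move=> x y z xy yz xz; rewrite -eqh //; apply: (implyP (cF _)).
  by rewrite -setUA cardsU1 cards2 !inE negb_or xy xz yz.
move=> S; apply/implyP => /[dup] /eqP S3.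
have /card_gt0P[x xS] : 0 < #|S| by rewrite S3.
rewrite (cardsD1 x) xS => /cards2P[y [z [yz Syz]]].
have : x \notin [set y; z] by rewrite -Syz !inE eqxx.
rewrite !inE negb_or => /andP[xy xz].
have -> : S = [set x; y; z] by rewrite -setUA -Syz setD1K.
by rewrite eqh // cF.
Qed.

Lemma misses_le2 (n : nat) (c : coloring n) (S : {set 'I_n}) :
  reflect (exists a, misses (kcol c) S a) (#|c @: edges_in S| <= 2).
Proof.
have card3 : #|{: color}| = 3.
  rewrite (bij_eq_card (f := ord_of_color)) ?card_ord //.
  exists color_of_ord => [|i]; first exact: ord_of_colorK.
  by apply/val_inj; case: i => -[|[|[|]]].
apply: (iffP idP) => [le2 | [a ma]].
  have /subsetPn[a _ aS] : ~~ ([set: color] \subset c @: edges_in S).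
    by apply: contraL le2 => /subset_leq_card; rewrite cardsT card3 -ltnNge.
  exists a => x y xS yS xy kxy; have [e ve] := edge_ex xy.
  case/imsetP: aS; exists e; last by rewrite (kcol_edge c ve).
  by rewrite inE ve subUset !sub1set xS yS.
have /subset_leq_card : c @: edges_in S \subset [set~ a].
  apply/subsetP => _ /imsetP[e eS ->]; rewrite !inE; apply/eqP.
  have /cards2P[x [y [xy ve]]] := valP e; move: eS.
  rewrite inE (kcol_edge c ve) ve subUset !sub1set => /andP[xS yS].
  exact: ma.
by rewrite cardsC1 card3.
Qed.

(** Once a blue and a yellow edge meet, [bby] forbids blue and [yyb] forbids yellow on the third
    edge. *)
Lemma tame_Forb (n : nat) (c : coloring n) :
  c \in Forb n [:: rrr; bby; yyb] -> tame (kcol c) Blue Yellow.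
Proof.
move/ForbP=> cF; split=> //.
- by move=> x y; case: (kcol c x y); [constructor 3|constructor 1|constructor 2].
- exact: kcolC.
- exact: kcol_diag.
- move=> x y z xy yz xz exy eyz exz.
  by have := cF x y z xy yz xz; rewrite exy eyz exz.
- move=> x y z exy exz.
  have neq u w : kcol c u w <> Red -> u != w.
    by move=> nR; apply/eqP => uw; apply: nR; rewrite uw kcol_diag.
  have xy : x != y by apply: neq; rewrite exy.
  have xz : x != z by apply: neq; rewrite exz.
  have yz : y != z by apply/eqP => yz; move: exz; rewrite -yz exy.
  by have := cF x y z xy yz xz; rewrite exy exz; case: (kcol c y z).
Qed.

Lemma h2_lower (n : nat) (c : coloring n) :
  c \in Forb n [:: rrr; bby; yyb] -> uphalf n <= h2 c.
Proof.
move=> /tame_Forb/tame_large[S [a [mS]]]; rewrite card_ord => le.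
apply: (@leq_trans #|S|); first lia.
apply: (@leq_bigmax_cond _ _ (fun S : {set 'I_n} => #|S|)).
by apply/misses_le2; exists a.
Qed.

(** * Upper bound: the matched cliques *)

Lemma coloring_of (n : nat) (k : 'I_n -> 'I_n -> color) :
  (forall x y, k x y = k y x) ->
  exists c : coloring n, forall x y, x != y -> kcol c x y = k x y.
Proof.
move=> kC.
(* The [pick] returns the ends of [e] in one of two orders, and symmetry of [k] makes them
   equivalent. The default [Red] is never reached, as every edge is a pair. *)
exists [ffun e : edge n => if [pick u : 'I_n * 'I_n | val e == [set u.1; u.2]]
  is Some u then k u.1 u.2 else Red] => x y xy.
have [e ve] := edge_ex xy; rewrite -(kcol_edge _ ve) ffunE.
case: pickP => [[u w] /= | /(_ (x, y))]; last by rewrite ve eqxx.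
rewrite ve => /eqP E.
have : u \in [set x; y] by rewrite E !inE eqxx.
have : w \in [set x; y] by rewrite E !inE eqxx orbT.
have : x \in [set u; w] by rewrite -E !inE eqxx.
have : y \in [set u; w] by rewrite -E !inE eqxx orbT.
rewrite !inE => /orP[]/eqP ? /orP[]/eqP ? /orP[]/eqP ? /orP[]/eqP ?; subst;
  by rewrite ?eqxx in xy *.
Qed.

(* Vertices [i < m] form one blue clique, the others a second one, and [i] is
   matched with [i + m]. *)
Definition side (m i : nat) : bool := i < m.
Definition pos (m i : nat) : nat := if i < m then i else i - m.
Definition matched_cliques (m i j : nat) : color :=
  if side m i == side m j then Blue
  else if pos m i == pos m j then Yellow else Red.

Lemma matched_cliquesC (m i j : nat) :
  matched_cliques m i j = matched_cliques m j i.
Proof. by rewrite /matched_cliques eq_sym [pos m i == _]eq_sym. Qed.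

Lemma side_pos_inj (m i j : nat) : side m i = side m j -> pos m i = pos m j -> i = j.
Proof. rewrite /side /pos; case: (ltnP i m) => hi; case: (ltnP j m) => hj // _; lia. Qed.

Lemma matched_cliques_misses (n : nat) (S : {set 'I_n}) (a : color) : 2 < n ->
  misses (fun i j : 'I_n => matched_cliques (uphalf n) i j) S a ->
  #|S| <= uphalf n.
Proof.
(* Any two vertices span at most two colors, so [m] must be at least 2. This is where [2 < n]
   enters; for [n = 2] the whole graph is two-colored and exceeds [uphalf n = 1]. *)
move=> n2 mS; set m := uphalf n; have m2 : 1 < m by rewrite /m; lia.
have posP (i : 'I_n) : pos m i < m.
  by rewrite /pos; case: (ltnP i m) => //; have := ltn_ord i; rewrite /m; lia.
have by_pos : {in S &, injective (fun i : 'I_n => Ordinal (posP i))} -> #|S| <= m.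
  by move/card_in_imset => <-; rewrite -[X in _ <= X]card_ord max_card.
case: a mS => mS.
(* No red: without a matched pair in [S], positions are distinct; with a matched pair [i], [j], the
   set [S] is just that pair. *)
- have [inj | ninj] := boolP [forall i in S, forall j in S,
      (pos m i == pos m j) ==> (i == j)].
    apply: by_pos => i j iS jS [] /eqP e.
    by apply/eqP; apply: implyP e; apply: (forall_inP (forall_inP inj i iS)).
  case/forall_inPn: ninj => i iS /forall_inPn[j jS].
  rewrite negb_imply => /andP[/eqP eij nij].
  have sij : side m i != side m j.
    by apply: contraNneq nij => s; apply/eqP/val_inj/(side_pos_inj s eij).
  (* A vertex [l] on the side of [i] has a non-red edge to [j], so it is matched with [j] and equals
     [i]; likewise with [i] and [j] exchanged. *)
  have sub : S \subset [set i; j].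
    apply/subsetP => l lS; rewrite !inE; apply/norP => -[li lj].
    have red u : u \in S -> l != u -> side m l != side m u -> pos m l = pos m u.
      move=> uS lu /negPf sl; have := mS l u lS uS lu; rewrite /matched_cliques sl.
      by case: eqP.
    have [sl | sl] : side m l = side m i \/ side m l = side m j.
    - by move: sij; case: (side m l) (side m i) (side m j) => -[] [] //; auto.
    - by case/eqP: li; apply/val_inj/(side_pos_inj sl); rewrite eij; apply: red => //; rewrite sl.
    - case/eqP: lj; apply/val_inj/(side_pos_inj sl).
      by rewrite -eij; apply: red => //; rewrite sl eq_sym.
  by have := subset_leq_card sub; rewrite cards2 nij; lia.
(* No blue: at most one vertex on each side, hence at most two in all. *)
- apply: leq_trans m2; rewrite -card_bool.
  rewrite -(card_in_imset (f := fun i : 'I_n => side m i)) ?max_card //.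
  move=> i j iS jS /= e; apply/eqP/negPn/negP => nij.
  by case: (mS i j iS jS nij); rewrite /matched_cliques e eqxx.
(* No yellow: at most one vertex from each matched pair, so positions are distinct. *)
- apply: by_pos => i j iS jS [] e; apply/eqP/negPn/negP => nij.
  have := mS i j iS jS nij; rewrite /matched_cliques e eqxx.
  case: eqP => // s; case/eqP: nij; exact/val_inj/(side_pos_inj s e).
Qed.

(** A triangle has two vertices on one side, hence a blue edge, which excludes [rrr]. If the third
    vertex lies on the other side, it is matched with at most one of them, so a red edge occurs;
    otherwise all three edges are blue. *)
Lemma matched_cliques_Forb (n m : nat) (c : coloring n) :
  (forall x y, x != y -> kcol c x y = matched_cliques m x y) ->
  c \in Forb n [:: rrr; bby; yyb].
Proof.
move=> cE; apply/ForbP => x y z xy yz xz; rewrite !cE // /matched_cliques.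
have npos (u w : 'I_n) : u != w -> side m u = side m w -> pos m u <> pos m w.
  by move=> uw s e; case/eqP: uw; apply/val_inj/(side_pos_inj s e).
move: (npos x y xy) (npos x z xz) (npos y z yz).
case: (side m x) (side m y) (side m z) => -[] [] //= nxy nxz nyz;
  do 2?case: eqP => //; intuition congruence.
Qed.

Lemma bigminn_le (I : finType) (P : pred I) (F : I -> nat) (n : nat) (i : I) :
  P i -> \big[minn/n]_(j | P j) F j <= F i.
Proof.
move=> Pi; have := mem_index_enum i; elim: (index_enum I) => // j r IHr.
rewrite inE big_cons; case: eqVneq => [<- _ | _ /= /IHr le].
  by rewrite Pi geq_minl.
by case: ifP => // _; rewrite (leq_trans (geq_minr _ _)).
Qed.

Lemma h2_upper (n : nat) : 2 < n ->
  exists2 c : coloring n, c \in Forb n [:: rrr; bby; yyb] & h2 c <= uphalf n.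
Proof.
move=> n2; pose k (x y : 'I_n) := matched_cliques (uphalf n) x y.
have [c cE] : exists c : coloring n, forall x y, x != y -> kcol c x y = k x y.
  by apply: coloring_of => x y; apply: matched_cliquesC.
exists c; first exact: matched_cliques_Forb cE.
apply/bigmax_leqP => S /misses_le2[a mS]; apply: (matched_cliques_misses n2 (a := a)).
by move=> x y xS yS xy; rewrite -[matched_cliques _ _ _]/(k x y) -cE //; apply: mS.
Qed.

Theorem lemma3p23 (n : nat) (hn : n <> 2) :
  h2_min n [:: rrr; bby; yyb] = uphalf n.
Proof.
have up : uphalf n <= n by lia.
apply/eqP; rewrite eqn_leq; apply/andP; split; last first.
  (* The starting value [n] of the minimum must satisfy the bound too; this is [up]. *)
  rewrite /h2_min; elim/big_ind: _ => // [u w lu lw | c /h2_lower //].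
  by rewrite leq_min lu.
have [n2 | n2] := ltnP 2 n.
  by have [c cF /(leq_trans _)] := h2_upper n2; apply; apply: bigminn_le.
(* Only [n = 0] and [n = 1] remain, where the starting value [n] already gives the upper bound. *)
have -> : uphalf n = n by move: hn n2; case: n {up} => [|[|[|]]].
rewrite /h2_min; elim/big_rec: _ => // c u _; exact: leq_trans (geq_minr _ _).
Qed.
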